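(* Let $\nu>0$. The function $b\mapsto Q_\nu(a,b)$ is log-concave on $[0,\infty)$ for all $a\ge 0$ if and only if $\nu\ge 1/2$.
   Context: For $\mu>-1$ and $t>0$, the modified Bessel function of the first kind is $I_\mu(t)=\sum_{k=0}^\infty \frac{(t/2)^{2k+\mu}}{k!\,\Gamma(\mu+k+1)}$. For $\nu>0$, $a,b\ge 0$, the generalized Marcum Q function is $$Q_\nu(a,b)=\int_b^\infty \frac{t^\nu}{a^{\nu-1}}\exp\left(-\frac{t^2+a^2}{2}\right)I_{\nu-1}(at)\,dt,$$ where $Q_\nu(0,b)$ is defined by taking the limit $a\downarrow 0$; explicitly $Q_\nu(0,b)=\int_b^\infty \frac{t^{2\nu-1}}{2^{\nu-1}\Gamma(\nu)}e^{-t^2/2}\,dt$. A nonnegative function $g$ on an interval $J$ is log-concave if $g(\lambda x+(1-\lambda)y)\ge g(x)^\lambda g(y)^{1-\lambda}$ for all $x,y\in J$, $\lambda\in(0,1)$. *)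

(* Defs.v *)
From mathcomp Require Import all_boot all_order all_algebra.
From mathcomp Require Import all_classical all_reals all_analysis.

Set Implicit Arguments.
Unset Strict Implicit.
Unset Printing Implicit Defensive.

Import Order.TTheory GRing.Theory Num.Theory.
Import numFieldNormedType.Exports.

Local Open Scope classical_set_scope.
Local Open Scope ring_scope.

Section marcumQ.
Variable R : realType.
Implicit Types (mu nu a b t x y l : R).

(* Euler's Gamma function; meaningful for x > 0 only. *)
Definition Gamma x : R :=
  \int[lebesgue_measure]_(t in `]0, +oo[) (t `^ (x - 1) * expR (- t)).

(* Meaningful for mu > -1 and t > 0, so that every Gamma argument is > 0. *)
Definition besselI mu t : R :=
  limn (series (fun k : nat =>
    (t / 2) `^ (2 * k%:R + mu) / (k`!%:R * Gamma (mu + k%:R + 1)))).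

Definition marcumQ_pos nu a b : R :=
  \int[lebesgue_measure]_(t in `]b, +oo[)
    (t `^ nu / a `^ (nu - 1) * expR (- ((t ^+ 2 + a ^+ 2) / 2))
     * besselI (nu - 1) (a * t)).

(* The integral formula is degenerate at a = 0, where Q is the limit as a tends to 0+. *)
Definition marcumQ nu a b : R :=
  if a == 0 then lim (marcumQ_pos nu a' b @[a' --> 0^'+])
  else marcumQ_pos nu a b.

Definition log_concave_on (J : interval R) (g : R -> R) : Prop :=
  (forall x, x \in J -> 0 <= g x) /\
  (forall x y l, x \in J -> y \in J -> 0 < l < 1 ->
    g x `^ l * g y `^ (1 - l) <= g (l * x + (1 - l) * y)).

End marcumQ.

(* Main.v *)
Require Import Defs.
From mathcomp Require Import all_boot all_order all_algebra.
From mathcomp Require Import all_classical all_reals all_analysis.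
From mathcomp Require Import measurable_realfun.
From mathcomp Require Import ring lra.

(** Put s = t^2.  Since I_(nu-1)(x) = (x/2)^(nu-1) F(x^2/4) with
    F(s) = sum_k s^k / (k! Gamma(nu+k)), the integrand of Q_nu(a, b) equals,
    up to the factor exp(-a^2/2), the function w(t^2) where
      w(s) = 2^(1-nu) s^(nu-1/2) exp(-s/2) F(a^2 s/4).

    F is log-concave on [0,oo[ for every nu > 0.  Its coefficients c_k have
    ratios (k+1) c_(k+1) / c_k = Gamma(nu+k) / Gamma(nu+k+1), nonincreasing
    because Gamma is log-convex, and this makes P'/P nonincreasing for every
    partial sum P of the series (wronskian_ge0, log_concave_poly,
    bessel_series_log_concave).  As s^(nu-1/2) is log-concave exactly when
    nu >= 1/2, so is w in that case.

    The density f(t) = w(t^2) itself need not be log-concave, but its tail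
    T(b) = int_b^oo f is.  By log_concave_derive this means that the hazard rate
    f/T is nondecreasing: f(b) T(c) <= f(c) T(b) for b < c.  If f(b) <= f(c),
    this holds because T decreases.  If f(b) > f(c), then log w goes down
    between b^2 and c^2, hence from there on by concavity, and the points
    (c+u)^2 move apart from (b+u)^2 as u grows; so log f drops at least as much
    between b+u and c+u as between b and c (log_concave_cross), and integrating
    f(b) f(c+u) <= f(c) f(b+u) over u > 0 gives the claim.  The case a = 0 is a
    pointwise limit: exp(a^2/2) Q_nu(a, b) is monotone in a, so the limit
    defining Q_nu(0, b) exists, and log-concavity is preserved.

    Conversely, a positive log-concave function on [0,oo[ has g(0) - g(b) = O(b)
    as b tends to 0 (log_concave_drop), whereas Q_nu(1, 0) - Q_nu(1, b) is at
    least of order b^(2 nu), because the density behaves like t^(2 nu - 1) at 0.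
    This is impossible when 2 nu < 1. *)

Set Implicit Arguments.
Unset Strict Implicit.
Unset Printing Implicit Defensive.

Import Order.TTheory GRing.Theory Num.Theory.
Import numFieldNormedType.Exports.

Local Open Scope classical_set_scope.
Local Open Scope ring_scope.

(** * Log-concave functions on the half-line *)

Section Log_concave.
Variable R : realType.
Implicit Types (f g w : R -> R) (x y s t l : R).

Local Notation lc := (log_concave_on `[0, +oo[).

Lemma continuous_powR_gt0 (p x : R) : 0 < x -> {for x, continuous (@powR R ^~ p)}.
Proof.
move=> x0; apply/differentiable_continuous/derivable1_diffP.
by apply: derivable_powR; rewrite in_itv/= andbT.
Qed.

(** Where the limit vanishes at an endpoint the inequality is trivial, the
    exponents being positive; elsewhere powers are continuous. *)
Lemma log_concave_cvg (I : topologicalType) (F : set_system I) (FF : ProperFilter F)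
    (h : I -> R -> R) (J : interval R) g :
  (forall x, x \in J -> h i x @[i --> F] --> g x) ->
  (\forall i \near F, log_concave_on J (h i)) ->
  (forall x y l, x \in J -> y \in J -> 0 < l < 1 -> l * x + (1 - l) * y \in J) ->
  log_concave_on J g.
Proof.
move=> hg hlc cJ.
have g0 x : x \in J -> 0 <= g x.
  move=> xJ; apply: (ler_cvg_to (cvg_cst 0) (hg _ xJ)).
  by apply: filterS hlc => i [/(_ _ xJ)].
split=> // x y l xJ yJ /andP[l0 l1].
have mJ : l * x + (1 - l) * y \in J by apply: cJ => //; rewrite l0.
have [gx0|gx0] := eqVneq (g x) 0.
  by rewrite gx0 powR0 ?gt_eqF// mul0r g0.
have [gy0|gy0] := eqVneq (g y) 0.
  by rewrite gy0 (@powR0 _ (1 - l)) ?gt_eqF ?subr_gt0// mulr0 g0.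
have gxp : 0 < g x by rewrite lt_neqAle eq_sym gx0 g0.
have gyp : 0 < g y by rewrite lt_neqAle eq_sym gy0 g0.
apply: (@ler_cvg_to _ _ FF _ (fun i => h i x `^ l * h i y `^ (1 - l))
  (fun i => h i (l * x + (1 - l) * y)) _ _ _ (hg _ mJ)).
  apply: cvgM.
  - exact: continuous_cvg (continuous_powR_gt0 gxp) (hg _ xJ).
  - exact: continuous_cvg (continuous_powR_gt0 gyp) (hg _ yJ).
by apply: filterS hlc => i [_]; apply => //; rewrite l0.
Qed.

Lemma conv_ge0 x y l : 0 <= x -> 0 <= y -> 0 < l < 1 -> 0 <= l * x + (1 - l) * y.
Proof. by move=> x0 y0 /andP[l0 l1]; nra. Qed.

Lemma log_concave_cst (k : R) : 0 < k -> lc (fun=> k).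
Proof.
move=> k0; split=> [x _|x y l _ _ _]; first exact: ltW.
by rewrite -powRD ?(gt_eqF k0) ?implybT// addrC subrK powRr1// ltW.
Qed.

Lemma eq_log_concave (J : interval R) (f g : R -> R) : {in J, f =1 g} ->
  (forall x y l, x \in J -> y \in J -> 0 < l < 1 -> l * x + (1 - l) * y \in J) ->
  log_concave_on J f -> log_concave_on J g.
Proof.
move=> fg cJ [f0 fc]; split=> [x xJ|x y l xJ yJ l01]; first by rewrite -fg ?f0.
by rewrite -!fg ?fc// cJ.
Qed.

Lemma log_concaveM f g : lc f -> lc g -> lc (fun x => f x * g x).
Proof.
move=> [f0 fc] [g0 gc]; split=> [x xJ|x y l xJ yJ l01].
  by rewrite mulr_ge0 ?f0 ?g0.
rewrite !powRM ?f0 ?g0// mulrACA ler_pM ?mulr_ge0 ?powR_ge0//.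
  exact: fc.
exact: gc.
Qed.

Lemma log_concave_scale f k : 0 <= k -> lc f -> lc (fun x => f (k * x)).
Proof.
move=> k0 [f0 fc]; split=> [x|x y l].
  by rewrite in_itv/= andbT => x0; apply: f0; rewrite in_itv/= andbT mulr_ge0.
rewrite !in_itv/= !andbT => x0 y0 l01.
have -> : k * (l * x + (1 - l) * y) = l * (k * x) + (1 - l) * (k * y) by ring.
by apply: fc; rewrite // in_itv/= andbT mulr_ge0.
Qed.

Lemma log_concave_expR (k : R) : lc (fun x => expR (k * x)).
Proof.
split=> [x _|x y l _ _ _]; first exact: expR_ge0.
rewrite -!expRM -expRD le_eqVlt; apply/orP; left; apply/eqP; congr expR.
ring.
Qed.

Lemma log_concave_ln g : (forall x, 0 <= x -> 0 < g x) ->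
  (forall x y l, 0 <= x -> 0 <= y -> x < y -> 0 < l < 1 ->
    l * ln (g x) + (1 - l) * ln (g y) <= ln (g (l * x + (1 - l) * y))) ->
  lc g.
Proof.
move=> g0 H; split=> [x|x y l]; first by rewrite in_itv/= andbT => /g0/ltW.
rewrite !in_itv/= !andbT => x0 y0 l01.
rewrite -ler_ln ?posrE ?mulr_gt0 ?powR_gt0 ?g0 ?conv_ge0//.
rewrite lnM ?posrE ?powR_gt0 ?g0// !ln_powR.
have [xy|yx|->] := ltgtP x y; first exact: H.
  have l01' : 0 < 1 - l < 1 by lra.
  have := H _ _ (1 - l) y0 x0 yx l01'.
  have -> : 1 - (1 - l) = l by ring.
  by rewrite addrC (addrC ((1 - l) * y)).
by rewrite -!mulrDl addrC subrK !mul1r.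
Qed.

(** For p = 1 this is the weighted inequality of means. *)
Lemma log_concave_powR (p : R) : 0 <= p -> lc (fun x => x `^ p).
Proof.
move=> p0; split=> [x _|x y l]; first exact: powR_ge0.
rewrite !in_itv/= !andbT => x0 y0 l01; have /andP[l0 l1] := l01.
rewrite -!powRrM !(mulrC p) !powRrM -powRM ?powR_ge0//.
apply: ge0_ler_powR => //; rewrite ?nnegrE ?mulr_ge0 ?powR_ge0 ?conv_ge0//.
have l1' : 0 < 1 - l by rewrite subr_gt0.
have := @conjugate_powR R (x `^ l) (y `^ (1 - l)) l^-1 (1 - l)^-1.
rewrite !powR_ge0 !invr_gt0 !invrK -!powRrM !mulfV ?gt_eqF// !powRr1//.
by rewrite !(mulrC _ l) !(mulrC _ (1 - l)); apply => //; rewrite addrC subrK.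
Qed.

(** The last hypothesis says that dg / g, the derivative of ln g, is
    nonincreasing, in a form free of division. *)
Lemma log_concave_derive g dg :
  (forall x, 0 <= x -> 0 < g x) ->
  (forall x y, 0 <= x < y -> {within `[x, y], continuous g}) ->
  (forall x, 0 < x -> is_derive x 1 g (dg x)) ->
  (forall x y, 0 < x < y -> dg y * g x <= dg x * g y) ->
  lc g.
Proof.
move=> g0 cg dgP ineq.
have mvt x y : 0 <= x < y ->
    exists2 c, x < c < y & ln (g y) - ln (g x) = dg c / g c * (y - x).
  move=> /andP[x0 xy].
  have [||c + ->] := @MVT R (fun x => ln (g x)) (fun x => dg x / g x) x y xy;
    last by rewrite in_itv/= => cxy; exists c.
  - move=> z; rewrite in_itv/= => /andP[xz zy].
    have z0 : 0 < z by exact: le_lt_trans xz.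
    rewrite mulrC.
    apply: is_derive1_comp; [exact: is_derive1_ln (g0 _ (ltW z0))|exact: dgP].
  - apply: (@within_continuous_comp _ _ _ _ g); last by apply: cg; rewrite x0.
    move=> u /set_mem[z /=]; rewrite in_itv/= => /andP[xz _] <-.
    exact/continuous_ln/g0/(le_trans x0).
apply: log_concave_ln => // x y l x0 y0 xy /andP[l0 l1].
set m := l * x + (1 - l) * y.
have xm : x < m by rewrite /m; nra.
have my : m < y by rewrite /m; nra.
have [|c /andP[xc cm] E1] := mvt x m; first by rewrite x0.
have [|d /andP[md dy] E2] := mvt m y; first by rewrite (le_trans x0 (ltW xm)).
have c0 : 0 < c by exact: le_lt_trans xc.
have cd : c < d by exact: lt_trans md.
have gc : 0 < g c by exact/g0/ltW.
have gd : 0 < g d by exact/g0/ltW/(lt_trans c0).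
have : dg d / g d <= dg c / g c.
  by rewrite ler_pdivrMr// mulrAC ler_pdivlMr// ineq ?c0.
set A := dg d / g d in E2 *; set B := dg c / g c in E1 * => AB.
have yx : 0 < y - x by rewrite subr_gt0.
have e1 : m - x = (1 - l) * (y - x) by rewrite /m; ring.
have e2 : y - m = l * (y - x) by rewrite /m; ring.
rewrite {}e1 in E1; rewrite {}e2 in E2.
have : 0 <= (B - A) * (l * (1 - l) * (y - x)).
  by rewrite mulr_ge0 ?subr_ge0// !mulr_ge0// ?subr_ge0 ltW.
move: (ln (g x)) (ln (g y)) (ln (g m)) E1 E2 => X Y M E1 E2.
have -> : X = M - B * ((1 - l) * (y - x)) by rewrite -E1; ring.
have -> : Y = M + A * (l * (y - x)) by rewrite -E2; ring.
nra.
Qed.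

End Log_concave.

(** * Polynomials whose coefficient ratios decrease *)

Section Criteria.
Variable R : realType.
Implicit Types (f g w : R -> R) (x y s t l : R).

Local Notation lc := (log_concave_on `[0, +oo[).

Lemma double_sum_ge0 n (a : 'I_n -> 'I_n -> R) :
  (forall i j, 0 <= a i j + a j i) -> 0 <= \sum_i \sum_j a i j.
Proof.
move=> a0; set S := \sum_i _.
have : 0 <= S + S.
  rewrite {2}/S exchange_big -big_split/= sumr_ge0// => i _.
  by rewrite -big_split sumr_ge0//= => j _.
lra.
Qed.

(** Pairing the indices (i, j) and (j, i) in the difference of the two products
    leaves (d_i c_j - d_j c_i) (s^i t^j - s^j t^i), whose factors have the same
    sign. *)
Lemma wronskian_ge0 n (c d : 'I_n -> R) :
  (forall i j : 'I_n, (i <= j)%N -> d j * c i <= d i * c j) ->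
  forall s t, 0 <= s <= t ->
  (\sum_i d i * t ^+ i) * (\sum_i c i * s ^+ i)
    <= (\sum_i d i * s ^+ i) * (\sum_i c i * t ^+ i).
Proof.
move=> dc s t /andP[s0 st]; have t0 := le_trans s0 st.
rewrite -subr_ge0 !big_distrlr/= -sumrB.
under eq_bigr do rewrite -sumrB.
have key (i j : 'I_n) : (i <= j)%N ->
    0 <= (d i * c j - d j * c i) * (s ^+ i * t ^+ j - s ^+ j * t ^+ i).
  move=> ij; rewrite mulr_ge0 ?subr_ge0 ?dc//.
  rewrite -(subnKC ij) !exprD.
  rewrite [leLHS](_ : _ = s ^+ i * t ^+ i * s ^+ (j - i)); last by ring.
  rewrite [leRHS](_ : _ = s ^+ i * t ^+ i * t ^+ (j - i)); last by ring.
  by rewrite ler_wpM2l ?mulr_ge0 ?exprn_ge0// lerXn2r.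
apply: double_sum_ge0 => i j.
rewrite [leRHS](_ : _ =
  (d i * c j - d j * c i) * (s ^+ i * t ^+ j - s ^+ j * t ^+ i)); last by ring.
have [/key//|/ltnW/key] := leqP i j.
by rewrite (_ : _ * _ =
  (d i * c j - d j * c i) * (s ^+ i * t ^+ j - s ^+ j * t ^+ i))//; ring.
Qed.

(** The ratios of the coefficients of P' to those of P are nonincreasing: they
    are (k+1) c_(k+1) / c_k for k < n, then 0.  So wronskian_ge0 shows that P'/P
    is nonincreasing. *)
Lemma log_concave_poly (c : nat -> R) n :
  (forall k, 0 < c k) ->
  (forall j k, (j <= k)%N -> k.+1%:R * c k.+1 * c j <= j.+1%:R * c j.+1 * c k) ->
  lc (fun s => \sum_(0 <= k < n.+1) c k * s ^+ k).
Proof.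
move=> c0 cc.
pose p : {poly R} := \poly_(k < n.+1) c k.
pose d k := if (k < n)%N then k.+1%:R * c k.+1 else 0.
have pE : (fun s => \sum_(0 <= k < n.+1) c k * s ^+ k) = horner p.
  by apply/funext => s; rewrite horner_poly big_mkord.
have dpE s : p^`().[s] = \sum_(k < n.+1) d k * s ^+ k.
  have -> : p^`() = \poly_(k < n.+1) d k.
    apply/polyP => k; rewrite coef_deriv !coef_poly /d ltnS.
    case: ltnP => kn; last by rewrite mul0rn; case: ifP.
    by rewrite leqW// mulr_natl.
  by rewrite horner_poly.
rewrite pE; apply: (@log_concave_derive _ _ (horner p^`())).
- move=> x x0; rewrite -pE big_nat_recl// expr0 mulr1 ltr_wpDr//.
  by rewrite sumr_ge0// => i _; rewrite mulr_ge0 ?exprn_ge0// ltW.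
- by move=> x y xy; apply: continuous_subspaceT => z; exact: continuous_horner.
move=> x y /andP[x0 xy]; rewrite !dpE -!pE !big_mkord.
apply: wronskian_ge0; last by rewrite !ltW.
move=> i j ij; rewrite /d; case: ltnP => jn; last first.
  by rewrite mul0r mulr_ge0// ?(ltW (c0 _))//; case: ifP => // _; rewrite mulr_ge0 ?ltW.
by rewrite (leq_ltn_trans ij jn) cc.
Qed.

(** * Log-concavity in the square of the variable *)

Lemma log_concave_chord f x y z : lc f -> 0 <= x -> x < y < z -> 0 < f x -> 0 < f z ->
  (z - y) * ln (f x) + (y - x) * ln (f z) <= (z - x) * ln (f y).
Proof.
move=> [f0 fc] x0 /andP[xy yz] fx fz.
have zx : 0 < z - x by lra.
pose l := (z - y) / (z - x).
have l1 : 1 - l = (y - x) / (z - x) by rewrite /l; field; lra.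
have l01 : 0 < l < 1.
  by rewrite -(subr_gt0 l) l1 !divr_gt0// subr_gt0.
have yE : l * x + (1 - l) * z = y by rewrite l1 /l; field; lra.
have z0 : 0 <= z by lra.
have := fc x z l; rewrite !in_itv/= !andbT => /(_ x0 z0 l01); rewrite yE => H.
have fy : 0 < f y by rewrite (lt_le_trans _ H)// mulr_gt0// powR_gt0.
move: H; rewrite -ler_ln ?posrE ?mulr_gt0 ?powR_gt0// lnM ?posrE ?powR_gt0//.
rewrite !ln_powR l1 /l => H.
rewrite -(ler_pM2l zx) in H; apply: le_trans H; rewrite le_eqVlt; apply/orP; left.
by apply/eqP; field; lra.
Qed.

(** Both c^2 and (b+u)^2 lie between b^2 and (c+u)^2.  The chord inequalities at
    these two points add up to the logarithm of the claim, multiplied by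
    (c+u)^2 - b^2, with the extra term 2 u (c - b) (ln w(b^2) - ln w((c+u)^2)) on
    the left; here 2 u (c - b) is the excess of b^2 + (c+u)^2 over
    c^2 + (b+u)^2.  The extra term is nonnegative because ln w, concave and
    smaller at c^2 than at b^2, stays below its value at b^2 afterwards. *)
Lemma log_concave_cross w (b c u : R) : lc w -> (forall x, 0 < x -> 0 < w x) ->
  0 < b < c -> 0 <= u -> w (c ^+ 2) < w (b ^+ 2) ->
  w (b ^+ 2) * w ((c + u) ^+ 2) <= w (c ^+ 2) * w ((b + u) ^+ 2).
Proof.
move=> wlc w0 /andP[b0 bc]; rewrite le_eqVlt => /predU1P[<-|u0 wcb].
  by rewrite !addr0 mulrC.
have sq0 x : 0 < x -> 0 < w (x ^+ 2) by move=> x0; rewrite w0// exprn_gt0.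
have c0 : 0 < c by lra.
have [wb wc] := (sq0 _ b0, sq0 _ c0).
have wbu : 0 < w ((b + u) ^+ 2) by rewrite sq0//; lra.
have wcu : 0 < w ((c + u) ^+ 2) by rewrite sq0//; lra.
rewrite -ler_ln ?posrE ?mulr_gt0// !lnM ?posrE//.
move: wcb; rewrite -ltr_ln ?posrE//.
have H1 : ((c + u) ^+ 2 - c ^+ 2) * ln (w (b ^+ 2))
    + (c ^+ 2 - b ^+ 2) * ln (w ((c + u) ^+ 2))
    <= ((c + u) ^+ 2 - b ^+ 2) * ln (w (c ^+ 2)).
  by apply: log_concave_chord => //; [exact: exprn_ge0 (ltW b0)|nra].
have H2 : ((c + u) ^+ 2 - (b + u) ^+ 2) * ln (w (b ^+ 2))
    + ((b + u) ^+ 2 - b ^+ 2) * ln (w ((c + u) ^+ 2))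
    <= ((c + u) ^+ 2 - b ^+ 2) * ln (w ((b + u) ^+ 2)).
  by apply: log_concave_chord => //; [exact: exprn_ge0 (ltW b0)|nra].
move: (ln (w (b ^+ 2))) (ln (w (c ^+ 2))) (ln (w ((b + u) ^+ 2)))
  (ln (w ((c + u) ^+ 2))) H1 H2 => B C X Y H1 H2 CB.
have p1 : 0 < (c + u) ^+ 2 - c ^+ 2 by nra.
have p2 : 0 < c ^+ 2 - b ^+ 2 by nra.
have p3 : 0 < (c + u) ^+ 2 - b ^+ 2 by nra.
have YB : Y <= B.
  rewrite leNgt; apply/negP => BY.
  have : 0 < (c ^+ 2 - b ^+ 2) * (Y - B) by rewrite mulr_gt0// subr_gt0.
  have : 0 < ((c + u) ^+ 2 - b ^+ 2) * (B - C) by rewrite mulr_gt0// subr_gt0.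
  lra.
rewrite -(ler_pM2l p3).
have : 0 <= 2 * u * (c - b) * (B - Y).
  by rewrite mulr_ge0 ?subr_ge0// !mulr_ge0// ?subr_ge0 ?ltW.
lra.
Qed.

End Criteria.

(** * Tails of densities *)

Section Tail.
Variable R : realType.
Local Notation mu := (@lebesgue_measure R).
Local Notation lc := (log_concave_on `[0, +oo[).

(** A vanishing integral would make f vanish almost everywhere on D, so D would
    be negligible. *)
Lemma Rintegral_gt0 (D : set R) (f : R -> R) : measurable D -> (0 < mu D)%E ->
  mu.-integrable D (EFin \o f) -> (forall x, D x -> 0 < f x) ->
  0 < \int[mu]_(x in D) f x.
Proof.
move=> mD D0 fi f0; rewrite lt_neqAle eq_sym Rintegral_ge0 ?andbT; last first.
  by move=> x /f0/ltW.
apply/negP => /eqP If0.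
have Ie : (\int[mu]_(x in D) `|(EFin \o f) x|)%E = 0.
  rewrite -[RHS]/(0%:E) -If0 /Rintegral fineK; last exact: integrable_fin_num.
  by apply: eq_integral => x /set_mem/f0 fx; rewrite /= gtr0_norm.
have /(ae_eq_integral_abs mu mD) := measurable_int mu fi.
move=> [/(_ Ie)/negligibleP + _].
have -> : ~` [set x | D x -> (EFin \o f) x = cst 0%E x] = D.
  apply/seteqP; split => x /=; first by move=> /not_implyP[].
  by move=> Dx /(_ Dx) [] fx0; have := f0 _ Dx; rewrite fx0 ltxx.
by move=> /(_ mD) D0'; rewrite D0' ltxx in D0.
Qed.

Lemma lebesgue_measure_itvy_gt0 (b : R) : (0 < mu `]b, +oo[)%E.
Proof. by rewrite lebesgue_measure_itv/= ltry addye. Qed.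

Lemma integrableZl_EFin (D : set R) (k : R) (f : R -> R) : measurable D ->
  mu.-integrable D (EFin \o f) -> mu.-integrable D (EFin \o (fun x => k * f x)).
Proof.
move=> mD fi; apply: eq_integrable (@integrableZl _ _ _ mu D mD k _ fi) => //.
Qed.

Lemma integrableD_EFin (D : set R) (f g : R -> R) : measurable D ->
  mu.-integrable D (EFin \o f) -> mu.-integrable D (EFin \o g) ->
  mu.-integrable D (EFin \o (fun x => f x + g x)).
Proof.
by move=> mD fi gi; apply: eq_integrable (@integrableD _ _ _ mu D mD _ _ fi gi).
Qed.

Lemma measurable_fun_itvoy (b : R) (f : R -> R) :
  {in `]b, +oo[, continuous f} -> measurable_fun `]b, +oo[ f.
Proof.
move=> cf; apply: open_continuous_measurable_fun; first exact: interval_open.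
by move=> x; rewrite inE; exact: cf.
Qed.

Section tail_of_f.
Variable f : R -> R.
Hypothesis fi : mu.-integrable `]0, +oo[ (EFin \o f).
Hypothesis f0 : forall t : R, 0 < t -> 0 < f t.
Hypothesis cf : {in `]0, +oo[, continuous f}.

Definition tail (b : R) : R := \int[mu]_(t in `]b, +oo[) f t.

Lemma tail_integrable (b : R) : 0 <= b -> mu.-integrable `]b, +oo[ (EFin \o f).
Proof.
move=> b0; apply: integrableS fi => //.
by apply: subset_itvr; rewrite bnd_simp.
Qed.

Lemma tail_gt0 (b : R) : 0 <= b -> 0 < tail b.
Proof.
move=> b0; apply: Rintegral_gt0 => //.
- exact: lebesgue_measure_itvy_gt0.
- exact: tail_integrable.
by move=> x /=; rewrite in_itv/= andbT => bx; apply/f0/(le_lt_trans b0).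
Qed.

Lemma tailB (x y : R) : 0 <= x <= y ->
  tail x - tail y = \int[mu]_(t in `]x, y]) f t.
Proof.
move=> /andP[x0 xy].
rewrite /tail -(@Rintegral_itvB _ f (BRight x) +oo%O y) ?bnd_simp//.
  by rewrite opprB addrC subrK.
exact: tail_integrable.
Qed.

Lemma tail_le (x y : R) : 0 <= x <= y -> tail y <= tail x.
Proof.
move=> /[dup]/tailB + /andP[x0 xy]; rewrite -subr_ge0 => ->.
apply: Rintegral_ge0 => t /=; rewrite in_itv/= => /andP[xt _].
by apply/ltW/f0/(le_lt_trans x0).
Qed.

Lemma measurable_shift (b u : R) : 0 < b -> 0 <= u ->
  measurable_fun `]b, +oo[ (fun t => (f (t + u))%:E).
Proof.
move=> b0 u0; apply/measurable_EFinP; apply: measurable_fun_itvoy => x.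
rewrite in_itv/= andbT => bx; apply: continuous_comp.
  exact: cvgD (cvg_id) (cvg_cst _).
by apply: cf; rewrite in_itv/= andbT ltr_wpDr// (lt_trans b0).
Qed.

Lemma integral_shift (b u : R) : 0 < b -> 0 <= u ->
  (\int[mu]_(t in `]b, +oo[) (f (t + u)%R)%:E =
   \int[mu]_(t in `](b + u)%R, +oo[) (f t)%:E)%E.
Proof.
move=> b0 u0.
have d1 (x : R) : is_derive x 1 (fun t : R => t + u) 1.
  by have := @is_deriveD _ _ _ id (cst u) x 1 1 0 _ _; rewrite addr0; apply.
have d1E : (fun t : R => t + u)^`()%classic = cst 1.
  by apply/funext => x; rewrite derive1E; apply: derive_val.
rewrite [RHS]integral_itv_obnd_cbnd; last first.
  by have /measurable_int := tail_integrable (addr_ge0 (ltW b0) u0).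
rewrite [RHS](@increasing_ge0_integration_by_substitutiony _ (fun t => t + u) f b).
- rewrite integral_itv_obnd_cbnd; last exact: measurable_shift.
  by apply: eq_integral => x _; rewrite d1E/= mulr1.
- by move=> x y _ _ xy; rewrite ltrD2r.
- by move=> x _; rewrite d1E; exact: cst_continuous.
- by rewrite d1E; exact: is_cvg_cst.
- by rewrite d1E; exact: is_cvg_cst.
- split=> [x _|]; first exact: ex_derive.
  by apply: cvg_at_right_filter; exact: cvgD (cvg_id) (cvg_cst _).
- exact: cvg_addrr.
- apply: continuous_in_subspaceT => x; rewrite inE/= in_itv/= andbT => bx.
  by apply: cf; rewrite in_itv/= andbT (lt_le_trans _ bx)// ltr_wpDr.
- move=> x; rewrite in_itv/= andbT => bx; apply/ltW/f0/(lt_trans _ bx).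
  by rewrite ltr_wpDr.
Qed.

Lemma tail_shift (b u : R) : 0 < b -> 0 <= u ->
  \int[mu]_(t in `]b, +oo[) f (t + u) = tail (b + u).
Proof. by move=> b0 u0; rewrite /tail /Rintegral integral_shift. Qed.

Lemma integrable_shift (b u : R) : 0 < b -> 0 <= u ->
  mu.-integrable `]b, +oo[ (fun t => (f (t + u))%:E).
Proof.
move=> b0 u0; apply/integrableP; split; first exact: measurable_shift.
have bu0 : 0 <= b + u by rewrite addr_ge0// ltW.
have /integrableP[_] := tail_integrable bu0; apply: le_lt_trans.
rewrite le_eqVlt; apply/orP; left; apply/eqP.
transitivity (\int[mu]_(t in `]b, +oo[) (f (t + u)%R)%:E)%E.
  apply: eq_integral => t; rewrite inE/= in_itv/= andbT => bt.
  by rewrite ger0_norm// ltW// f0// ltr_wpDr// (lt_trans b0).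
rewrite integral_shift//; apply: eq_integral => t.
rewrite inE/= in_itv/= andbT => but.
by rewrite ger0_norm// ltW// f0// (le_lt_trans bu0).
Qed.

Lemma tail_derive (b : R) : 0 < b -> is_derive b 1 tail (- f b).
Proof.
move=> b0.
have b1 : b < b + 1 by rewrite ltrDl.
have fi1 : mu.-integrable `]0, b + 1] (EFin \o f).
  by apply: integrableS fi => //; apply: subset_itvl; rewrite bnd_simp.
have b0' : (BRight 0 < BRight b :> itv_bound R)%O by rewrite bnd_simp.
have cfb : {for b, continuous f} by apply: cf; rewrite in_itv/= andbT.
have [] := continuous_FTC1 b1 fi1 b0' cfb.
set G := (fun x0 => _) => dG GE.
have dtail : is_derive b 1 (fun x => tail 0 - G x) (- f b).
  rewrite -[- f b]add0r.
  apply: is_deriveB; rewrite -GE derive1E; exact: DeriveDef.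
apply: near_eq_is_derive dtail => //.
near=> x; have x0 : 0 < x by near: x; exact: lt_nbhsr.
by rewrite /G -tailB ?lexx ?ltW// opprB addrC subrK.
Unshelve. all: by end_near. Qed.

(** Continuity at 0 is included; there f may be unbounded, or its value
    unrelated to the integrand, hence the extension by 0 in the proof. *)
Lemma tail_continuous (x y : R) : 0 <= x < y -> {within `[x, y], continuous tail}.
Proof.
move=> /andP[x0 xy]; pose g := f \_ `]0, +oo[.
have gi : mu.-integrable setT (EFin \o g).
  by rewrite -restrict_EFin; apply/(integrable_mkcond _ _).1.
have gi' : mu.-integrable `[x, y] (EFin \o g) by exact: integrableS gi.
have := parameterized_integral_continuous (ltW xy) gi'.
move=> cG.
apply: (@subspace_eq_continuous _ _ _
  (fun z => tail x - parameterized_integral mu x z g)).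
  move=> z /=; rewrite inE/= in_itv/= => /andP[xz zy].
  rewrite /parameterized_integral -Rintegral_itv_obnd_cbnd; last exact: integrableS gi.
  rewrite (_ : \int[mu]_(t in _) g t = \int[mu]_(t in `]x, z]) f t).
    by rewrite -tailB ?x0// opprB addrC subrK.
  apply: eq_Rintegral => t; rewrite inE/= in_itv/= => /andP[xt _].
  by rewrite /g patchE ifT// inE/= in_itv/= andbT (le_lt_trans x0).
apply: (@within_continuousB _ _ _ _ (cst (tail x)) _ _ cG).
by apply: continuous_subspaceT => z; exact: cst_continuous.
Qed.

(** If f c < f b, the hypothesis at u = t - b compares the integrands, once the
    integral from c is shifted to start at b. *)
Lemma tail_hazard (b c : R) : 0 < b < c ->
  (forall u, 0 < u -> f c < f b -> f b * f (c + u) <= f c * f (b + u)) ->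
  f b * tail c <= f c * tail b.
Proof.
move=> /andP[b0 bc] H; have c0 : 0 < c by exact: lt_trans bc.
have [fbc|fcb] := leP (f b) (f c).
  apply: ler_pM => //; [exact/ltW/f0|exact/ltW/tail_gt0/ltW|].
  by apply: tail_le; rewrite !ltW.
have cb : 0 < c - b by rewrite subr_gt0.
have -> : tail c = \int[mu]_(t in `]b, +oo[) f (t + (c - b)).
  by rewrite tail_shift ?ltW// addrC subrK.
rewrite -!RintegralZl//.
- apply: le_Rintegral => //.
  + by apply: integrableZl_EFin => //; apply: integrable_shift => //; exact: ltW.
  + by apply: integrableZl_EFin => //; apply: tail_integrable; exact: ltW.
  move=> t /=; rewrite in_itv/= andbT => bt.
  have := H (t - b); rewrite subr_gt0 (addrC b) subrK => /(_ bt fcb).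
  by rewrite addrCA (addrC c).
- by apply: tail_integrable; exact: ltW.
- by apply: integrable_shift => //; exact: ltW.
Qed.

End tail_of_f.

(** By log_concave_derive, applied to the tail and its derivative - f, it is
    enough that the hazard rate be nondecreasing.  The density f itself need not
    be log-concave. *)
Lemma log_concave_tail (w : R -> R) (f : R -> R) :
  lc w -> (forall x, 0 < x -> 0 < w x) -> (forall t, 0 < t -> f t = w (t ^+ 2)) ->
  {in `]0, +oo[, continuous f} -> mu.-integrable `]0, +oo[ (EFin \o f) ->
  lc (tail f).
Proof.
move=> wlc w0 fw cf fi.
have f0 t : 0 < t -> 0 < f t by move=> t0; rewrite fw ?w0 ?exprn_gt0.
apply: (@log_concave_derive _ _ (fun b => - f b)).
- exact: tail_gt0.
- exact: tail_continuous.
- exact: tail_derive.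
move=> b c /andP[b0 bc]; rewrite !mulNr lerN2; apply: tail_hazard => //.
  by rewrite b0.
move=> u u0; have c0 := lt_trans b0 bc.
rewrite !fw ?addr_gt0// => fcb; apply: log_concave_cross => //; first by rewrite b0.
exact: ltW.
Qed.

End Tail.

(** * The Gamma function *)

Section Integrability.
Variable R : realType.
Local Notation mu := (@lebesgue_measure R).

(** Over [1/(n+2), n+2] the integral of h is a difference of two values of F,
    hence at most M - m, and these intervals exhaust ]0, +oo[. *)
Lemma integrable_bounded_primitive (F h : R -> R) (m M : R) :
  {in `]0, +oo[, continuous h} ->
  (forall x : R, 0 < x -> is_derive x 1 F (h x)) ->
  (forall x : R, 0 < x -> 0 <= h x) ->
  (forall x : R, 0 < x -> m <= F x <= M) ->
  mu.-integrable `]0, +oo[ (EFin \o h).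
Proof.
move=> ch dF h0 Fb.
have mh : measurable_fun `](0 : R), +oo[ h by exact: measurable_fun_itvoy.
pose I (n : nat) : set R := `[n.+2%:R^-1 : R, n.+2%:R]%classic.
have I0 n : I n `<=` `](0 : R), +oo[.
  by move=> t; rewrite /I/= !in_itv/= andbT => /andP[+ _]; exact: lt_le_trans.
have UI : `](0 : R), +oo[%classic = \bigcup_n I n.
  apply/seteqP; split => [t|t [n _]]; last exact: I0.
  rewrite /= in_itv/= andbT => t0.
  have ti0 : 0 < t^-1 by rewrite invr_gt0.
  have := archi_boundP (ltW (addr_gt0 t0 ti0)); set n := Num.bound _ => tn.
  have nn : n%:R < n.+2%:R :> R by rewrite ltr_nat.
  exists n => //; rewrite /I/= in_itv/=; apply/andP; split; last by lra.
  by rewrite -[t]invrK lef_pV2 ?posrE ?invr_gt0//; lra.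
apply/integrableP; split; first exact/measurable_EFinP.
have -> : (\int[mu]_(x in `]0%R, +oo[) `|(EFin \o h) x| =
           \int[mu]_(x in `]0%R, +oo[) (h x)%:E)%E.
  by apply: eq_integral => t; rewrite inE/= in_itv/= andbT => /h0 ?; rewrite ger0_norm.
rewrite UI.
have nd : {homo I : n p / (n <= p)%N >-> (n <= p)%O}.
  move=> n p np; rewrite subsetEset; apply: subset_itv; rewrite bnd_simp.
    by rewrite lef_pV2 ?posrE// ler_nat.
  by rewrite ler_nat.
apply: (@le_lt_trans _ _ (M - m)%:E); last exact: ltry.
have intI :=
  @ge0_nondecreasing_set_cvg_integral _ (measurableTypeR R) R I (EFin \o h) mu nd.
apply: (cvge_to_le (intI _ _ _)).
- by move=> n; exact: measurable_itv.
- move=> n; apply/measurable_EFinP; apply: measurable_funS mh => //.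
- by move=> n x /I0; rewrite /= in_itv/= andbT lee_fin => /h0.
apply: nearW => n.
have nn : n.+2%:R^-1 < n.+2%:R :> R.
  by rewrite (@le_lt_trans _ _ 1) ?invf_le1 ?ler1n ?ltr1n.
have [n0 n0'] : 0 < n.+2%:R :> R /\ 0 < n.+2%:R^-1 :> R by rewrite invr_gt0.
have Fd (x : R) : 0 < x -> derivable F x 1 by move=> /dF [].
have Fc (x : R) : 0 < x -> {for x, continuous F}.
  by move=> /Fd ?; apply/differentiable_continuous/derivable1_diffP.
rewrite (@continuous_FTC2 _ _ F)//.
- rewrite -EFinB lee_fin; have := Fb _ n0; have := Fb _ n0'; lra.
- apply: continuous_in_subspaceT => x; rewrite inE => /I0.
  exact: ch.
- split=> [x||].
  + by rewrite in_itv/= => /andP[nx _]; apply/Fd/(lt_trans n0').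
  + by apply: cvg_at_right_filter; exact: Fc.
  + by apply: cvg_at_left_filter; exact: Fc.
- move=> x; rewrite in_itv/= => /andP[nx _].
  rewrite derive1E; apply: derive_val; apply: dF; exact: lt_trans nx.
Qed.

End Integrability.

Section Gamma.
Variable R : realType.
Local Notation mu := (@lebesgue_measure R).
Implicit Types x t : R.

Lemma is_derive_powR (p t : R) : 0 < t ->
  is_derive t 1 (@powR R ^~ p) (p * t `^ (p - 1)).
Proof.
move=> t0; have tI : t \in `]0, +oo[ by rewrite in_itv/= andbT.
by apply: DeriveDef; [exact: derivable_powR|rewrite -derive1E powR_derive1].
Qed.

(** This is y <= expR y at y = t / (2 x), raised to the power x. *)
Lemma powR_le_expR x t : 0 < x -> 0 < t -> t `^ x <= (2 * x) `^ x * expR (t / 2).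
Proof.
move=> x0 t0; have x2 : 0 < 2 * x by rewrite mulr_gt0.
rewrite {1}(_ : t = (2 * x) * (t / (2 * x))); last by field; lra.
have tx : 0 < t / (2 * x) by rewrite divr_gt0.
rewrite powRM ?(ltW tx) ?(ltW x2)// ler_pM2l ?powR_gt0//.
rewrite (_ : t / 2 = (t / (2 * x)) * x); last by field; lra.
rewrite expRM ge0_ler_powR ?nnegrE ?expR_ge0 ?(ltW x0) ?(ltW tx)//.
by apply: le_trans (expR_ge1Dx _); rewrite lerDr.
Qed.

Definition gamma_density x t : R := t `^ (x - 1) * expR (- t).

Lemma gamma_density_gt0 x t : 0 < t -> 0 < gamma_density x t.
Proof. by move=> t0; rewrite mulr_gt0 ?powR_gt0 ?expR_gt0. Qed.

Lemma gamma_density_continuous x : {in `]0, +oo[, continuous (gamma_density x)}.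
Proof.
move=> t; rewrite in_itv/= andbT => t0; apply: cvgM.
  exact: continuous_powR_gt0.
by apply: continuous_comp; [exact: opp_continuous|exact: continuous_expR].
Qed.

(** The density is dominated on the whole half-line, near 0 and near infinity at
    once, by a multiple of the derivative of the bounded function
    - 1 / (1 + t^x), because (1 + t^x)^2 = O(e^t). *)
Lemma gamma_density_integrable x : 0 < x ->
  mu.-integrable `]0, +oo[ (EFin \o gamma_density x).
Proof.
move=> x0.
pose h t : R := x * t `^ (x - 1) / (1 + t `^ x) ^+ 2.
pose F t : R := - (1 + t `^ x)^-1.
have p0 t : 0 < 1 + t `^ x by rewrite ltr_pwDl// powR_ge0.
have ch : {in `]0, +oo[, continuous h}.
  move=> t; rewrite in_itv/= andbT => t0; apply: cvgM.
    by apply: cvgM; [exact: cvg_cst|exact: continuous_powR_gt0].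
  apply: cvgV; first by rewrite expf_neq0// gt_eqF.
  apply: (@continuous_comp _ _ _ (fun t => 1 + t `^ x) (fun y => y ^+ 2)).
    by apply: cvgD; [exact: cvg_cst|exact: continuous_powR_gt0].
  exact: exprn_continuous.
have hi : mu.-integrable `]0, +oo[ (EFin \o h).
  apply: (@integrable_bounded_primitive _ F h (-1) 0) => //.
  - move=> t t0; have d := is_derive_powR x t0.
    rewrite /F (_ : h t = - (- (1 + t `^ x) ^- 2 *: (0 + x * t `^ (x - 1)))).
      by apply: is_deriveN; apply: is_deriveV; rewrite ?gt_eqF.
    by rewrite add0r scaleNr opprK /h mulrC.
  - by move=> t t0; rewrite /h !mulr_ge0 ?powR_ge0 ?invr_ge0 ?exprn_ge0 ?ltW.
  - move=> t t0; rewrite /F lerN2 invf_le1 ?p0// lerDl powR_ge0/=.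
    by rewrite oppr_le0 invr_ge0 ltW.
pose K := (2 * x) `^ x.
have mg : measurable_fun `](0 : R), +oo[ (EFin \o gamma_density x).
  by apply/measurable_EFinP; apply: measurable_fun_itvoy; exact: gamma_density_continuous.
have {}hi := integrableZl_EFin ((1 + K) ^+ 2 / x) (measurable_itv _) hi.
apply: (@le_integrable _ _ _ mu _ _ _ _ mg _ hi) => // t /=.
rewrite in_itv/= andbT lee_fin => t0.
rewrite !ger0_norm; last 2 first.
  by rewrite !mulr_ge0 ?powR_ge0 ?invr_ge0 ?exprn_ge0 ?addr_ge0 ?powR_ge0// ltW.
  exact/ltW/gamma_density_gt0.
rewrite /gamma_density /h.
rewrite (_ : (1 + K) ^+ 2 / x * _ =
    t `^ (x - 1) * ((1 + K) ^+ 2 / (1 + t `^ x) ^+ 2)); last first.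
  by field; rewrite !gt_eqF.
rewrite ler_pM2l ?powR_gt0// ler_pdivlMr ?exprn_gt0//.
have : 1 + t `^ x <= (1 + K) * expR (t / 2).
  have := powR_le_expR x0 t0; rewrite -/K.
  have := expR_ge1Dx (t / 2); lra.
move=> H; have {}H : (1 + t `^ x) ^+ 2 <= ((1 + K) * expR (t / 2)) ^+ 2.
  apply: lerXn2r => //; rewrite nnegrE; first exact/ltW/p0.
  by apply: le_trans H; exact/ltW/p0.
rewrite exprMn -expRM_natr mulfVK ?pnatr_eq0// in H.
by rewrite expRN mulrC ler_pdivrMr ?expR_gt0.
Qed.

Lemma Gamma_gt0 x : 0 < x -> 0 < Gamma x.
Proof.
move=> x0; apply: tail_gt0 => //; first exact: gamma_density_integrable.
exact: gamma_density_gt0.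
Qed.

Lemma gamma_densityS x t : 0 < t -> gamma_density (x + 1) t = t * gamma_density x t.
Proof.
move=> t0; rewrite /gamma_density addrK mulrA; congr (_ * _).
rewrite -{2}[t](powRr1 (ltW t0)) -powRD; first by rewrite addrC subrK.
by rewrite (gt_eqF t0) implybT.
Qed.

Lemma gamma_densityDn x t n : 0 < t ->
  gamma_density (x + n%:R) t = t ^+ n * gamma_density x t.
Proof.
move=> t0; elim: n => [|n IH]; first by rewrite addr0 mul1r.
by rewrite -natr1 addrA gamma_densityS// IH exprS mulrA.
Qed.

(** The integral of the density times (t - l)^2 is nonnegative, and l is chosen
    as the minimizer of this quadratic in l. *)
Lemma Gamma_log_convex x : 0 < x -> Gamma (x + 1) ^+ 2 <= Gamma x * Gamma (x + 2).
Proof.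
move=> x0; have [x1 x2] : 0 < x + 1 /\ 0 < x + 2 by lra.
have G0 := Gamma_gt0 x0; pose l := Gamma (x + 1) / Gamma x.
have intD y : 0 < y -> mu.-integrable `]0, +oo[ (EFin \o gamma_density y).
  exact: gamma_density_integrable.
have H : 2 * l * Gamma (x + 1) <= Gamma (x + 2) + l ^+ 2 * Gamma x.
  rewrite /Gamma -!RintegralZl//; [|exact: intD..].
  rewrite -RintegralD//; [|exact: intD|exact/integrableZl_EFin/intD].
  apply: le_Rintegral => //.
  - exact/integrableZl_EFin/intD.
  - by apply: integrableD_EFin => //; [exact: intD|exact/integrableZl_EFin/intD].
  move=> t /=; rewrite in_itv/= andbT => t0.
  rewrite -/(gamma_density (x + 1) t) -/(gamma_density (x + 2) t) -/(gamma_density x t).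
  rewrite gamma_densityS// (gamma_densityDn _ 2)// -subr_ge0.
  rewrite [leRHS](_ : _ = gamma_density x t * (t - l) ^+ 2); last by ring.
  by rewrite mulr_ge0 ?sqr_ge0// ltW// gamma_density_gt0.
have : 2 * l * Gamma (x + 1) * Gamma x <= (Gamma (x + 2) + l ^+ 2 * Gamma x) * Gamma x.
  by rewrite ler_pM2r.
rewrite /l; move: G0; move: (Gamma x) (Gamma (x + 1)) (Gamma (x + 2)) => a b c a0.
rewrite (_ : 2 * (b / a) * b * a = 2 * b ^+ 2); last by field; lra.
rewrite (_ : (c + (b / a) ^+ 2 * a) * a = a * c + b ^+ 2); last by field; lra.
lra.
Qed.

(** Gamma (x + n) outgrows every geometric sequence: on ]N, +oo[ the factor t^n
    is at least N^n. *)
Lemma Gamma_ge_geometric x (N : R) n : 0 < x -> 0 < N ->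
  tail (gamma_density x) N * N ^+ n <= Gamma (x + n%:R).
Proof.
move=> x0 N0; have xn : 0 < x + n%:R by rewrite ltr_pwDl.
have gN y : 0 < y -> mu.-integrable `]N, +oo[ (EFin \o gamma_density y).
  by move=> y0; apply: tail_integrable; [exact: gamma_density_integrable|exact: ltW].
apply: (@le_trans _ _ (tail (gamma_density (x + n%:R)) N)).
  rewrite mulrC /tail -RintegralZl//; last exact: gN.
  apply: le_Rintegral => //; [exact/integrableZl_EFin/gN|exact: gN|].
  move=> t /=; rewrite in_itv/= andbT => Nt.
  have t0 := lt_trans N0 Nt.
  by rewrite gamma_densityDn// ler_pM2r ?gamma_density_gt0// lerXn2r ?nnegrE ?ltW.
apply: tail_le; [exact: gamma_density_integrable|exact: gamma_density_gt0|].
by rewrite lexx ltW.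
Qed.

End Gamma.

(** * The power series of the Bessel function *)

Section Bessel.
Variable R : realType.
Implicit Types nu s t : R.

Definition bessel_coef nu (k : nat) : R := (k`!%:R * Gamma (nu + k%:R))^-1.

Lemma bessel_coef_gt0 nu k : 0 < nu -> 0 < bessel_coef nu k.
Proof.
move=> nu0; rewrite invr_gt0 mulr_gt0 ?ltr0n ?fact_gt0// Gamma_gt0//.
by rewrite ltr_pwDl.
Qed.

(** Differentiating the series of parameter nu gives that of parameter nu + 1. *)
Lemma bessel_coefS nu k :
  k.+1%:R * bessel_coef nu k.+1 = bessel_coef (nu + 1) k.
Proof.
rewrite /bessel_coef -addrA nat1r factS natrM -mulrA [in LHS]invfM mulrA.
by rewrite mulfV ?mul1r// pnatr_eq0.
Qed.

Lemma pseries_diffs_bessel_coef nu :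
  pseries_diffs (bessel_coef nu) = bessel_coef (nu + 1).
Proof. by apply/funext => k; exact: bessel_coefS. Qed.

(** The ratio of consecutive values of Gamma is nondecreasing by log-convexity. *)
Lemma bessel_coef_ratio nu j k : 0 < nu -> (j <= k)%N ->
  k.+1%:R * bessel_coef nu k.+1 * bessel_coef nu j
    <= j.+1%:R * bessel_coef nu j.+1 * bessel_coef nu k.
Proof.
move=> nu0 jk; pose G (i : nat) : R := Gamma (nu + i%:R).
have G0 i : 0 < G i by apply: Gamma_gt0; rewrite ltr_pwDl.
have step i : G i.+1 / G i <= G i.+2 / G i.+1.
  rewrite ler_pdivrMr// mulrAC ler_pdivlMr// -expr2 mulrC.
  have := @Gamma_log_convex R (nu + i%:R).
  by rewrite -!addrA natr1 -natrD addn2; apply; rewrite ltr_pwDl.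
have : G j.+1 / G j <= G k.+1 / G k.
  exact: (@homo_leq _ (fun i => G i.+1 / G i) (fun a b => a <= b)
    (@lexx _ _) (fun y x z => @le_trans _ _ y x z) step _ _ jk).
rewrite ler_pdivrMr// mulrAC ler_pdivlMr// => H.
rewrite !bessel_coefS /bessel_coef -!addrA !nat1r -/(G _) -/(G _) -/(G _) -/(G _).
rewrite -!invfM lef_pV2 ?posrE ?mulr_gt0 ?ltr0n ?fact_gt0//.
rewrite [leLHS](_ : _ = k`!%:R * j`!%:R * (G j.+1 * G k)); last by ring.
rewrite [leRHS](_ : _ = k`!%:R * j`!%:R * (G k.+1 * G j)); last by ring.
by rewrite ler_pM2l ?mulr_gt0 ?ltr0n ?fact_gt0.
Qed.

Definition gamma_tail nu (N : R) : R := tail (gamma_density nu) N.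

Lemma gamma_tail_gt0 nu (N : R) : 0 < nu -> 0 < N -> 0 < gamma_tail nu N.
Proof.
move=> nu0 N0; apply: tail_gt0; [exact: gamma_density_integrable| |exact: ltW].
exact: gamma_density_gt0.
Qed.

(** Since N is arbitrary, this bounds the sum of the series by a multiple of
    exp(s/N), with a rate as small as desired. *)
Lemma bessel_term_le nu (N s : R) k : 0 < nu -> 0 < N -> 0 <= s ->
  bessel_coef nu k * s ^+ k <= (gamma_tail nu N)^-1 * exp_coeff (s / N) k.
Proof.
move=> nu0 N0 s0; have t0 := gamma_tail_gt0 nu0 N0.
have f0 : 0 < k`!%:R :> R by rewrite ltr0n fact_gt0.
have Nk : 0 < N ^+ k by rewrite exprn_gt0.
rewrite /exp_coeff/= [leRHS](_ : _ = (k`!%:R * (gamma_tail nu N * N ^+ k))^-1 * s ^+ k).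
  rewrite ler_wpM2r ?exprn_ge0// /bessel_coef lef_pV2 ?posrE ?mulr_gt0//.
    by rewrite ler_pM2l// Gamma_ge_geometric.
  by rewrite Gamma_gt0// ltr_pwDl.
by rewrite expr_div_n; field; rewrite !gt_eqF.
Qed.

Definition bessel_series nu (s : R) : R := limn (pseries (bessel_coef nu) s).

Lemma is_cvg_bessel_series nu (s : R) : 0 < nu -> cvgn (pseries (bessel_coef nu) s).
Proof.
move=> nu0; apply: normed_cvg.
pose b := (gamma_tail nu 1)^-1 *: exp_coeff (`|s| / 1).
apply: (@series_le_cvg _ _ b) => [n|n|n|].
- exact: normr_ge0.
- rewrite /b/= mulr_ge0 ?invr_ge0 ?exp_coeff_ge0 ?divr_ge0//.
  by rewrite ltW// gamma_tail_gt0.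
- by rewrite /= normrM normrX gtr0_norm ?bessel_coef_gt0//; exact: bessel_term_le.
- by apply: is_cvg_seriesZ; exact: is_cvg_series_exp_coeff.
Qed.

Lemma bessel_series_le_expR nu (N s : R) : 0 < nu -> 0 < N -> 0 <= s ->
  bessel_series nu s <= (gamma_tail nu N)^-1 * expR (s / N).
Proof.
move=> nu0 N0 s0; rewrite /expR -[leRHS](lim_seriesZ _ (is_cvg_series_exp_coeff _)).
apply: lim_series_le.
- exact: is_cvg_bessel_series.
- by apply: is_cvg_seriesZ; exact: is_cvg_series_exp_coeff.
- by move=> n; exact: bessel_term_le.
Qed.

Lemma bessel_series_le nu (s t : R) : 0 < nu -> 0 <= s <= t ->
  bessel_series nu s <= bessel_series nu t.
Proof.
move=> nu0 /andP[s0 st]; apply: lim_series_le; [exact: is_cvg_bessel_series..|].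
move=> n; apply: ler_wpM2l; first exact/ltW/bessel_coef_gt0.
by rewrite lerXn2r ?nnegrE// (le_trans s0).
Qed.

Lemma bessel_series0 nu : bessel_series nu 0 = bessel_coef nu 0.
Proof.
apply: cvg_lim => //; apply: (@cvg_near_cst _ _ _ _ \oo).
exists 1%N => // -[//|n _].
rewrite /pseries /series/= big_nat_recl// expr0 mulr1 big1 ?addr0// => i _.
by rewrite expr0n mulr0.
Qed.

Lemma bessel_series_gt0 nu (s : R) : 0 < nu -> 0 <= s -> 0 < bessel_series nu s.
Proof.
move=> nu0 s0; apply: (@lt_le_trans _ _ (bessel_coef nu 0)).
  exact: bessel_coef_gt0.
by rewrite -bessel_series0 bessel_series_le ?lexx.
Qed.

Lemma bessel_series_continuous nu : 0 < nu -> continuous (bessel_series nu).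
Proof.
move=> nu0 s; apply/differentiable_continuous/derivable1_diffP.
have [] // := @pseries_snd_diffs R (bessel_coef nu) (`|s| + 1) s _ _ _ _.
- exact: is_cvg_bessel_series.
- by rewrite pseries_diffs_bessel_coef; apply: is_cvg_bessel_series; lra.
- by rewrite !pseries_diffs_bessel_coef; apply: is_cvg_bessel_series; lra.
- by rewrite [ltRHS]ger0_norm ?addr_ge0// ltrDl.
Qed.

(** Only partial sums with at least one term are positive, hence log-concave
    by log_concave_poly. *)
Lemma bessel_series_log_concave nu : 0 < nu ->
  log_concave_on `[0, +oo[ (bessel_series nu).
Proof.
move=> nu0; apply: (@log_concave_cvg R _ \oo _ (fun n s => pseries (bessel_coef nu) s n)).
- by move=> s _; exact: is_cvg_bessel_series.
- exists 1%N => // -[//|n _]; apply: log_concave_poly => [k|j k jk].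
    exact: bessel_coef_gt0.
  exact: bessel_coef_ratio.
- move=> x y l; rewrite !in_itv/= !andbT; exact: conv_ge0.
Qed.

Lemma besselIE nu (x : R) : 0 < nu -> 0 < x ->
  besselI (nu - 1) x = (x / 2) `^ (nu - 1) * bessel_series nu ((x / 2) ^+ 2).
Proof.
move=> nu0 x0; have x2 : 0 < x / 2 by rewrite divr_gt0.
rewrite /bessel_series.
rewrite -[RHS](lim_seriesZ _ (@is_cvg_bessel_series nu ((x / 2) ^+ 2) nu0)).
congr (limn (series _)); apply/funext => k /=.
rewrite [in LHS]powRD; last by rewrite (gt_eqF x2) implybT.
rewrite -natrM powR_mulrn ?(ltW x2)// exprM /bessel_coef.
rewrite (_ : nu - 1 + k%:R + 1 = nu + k%:R); last by ring.
rewrite [RHS](_ : _ = (x / 2) `^ (nu - 1) *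
  ((k`!%:R * Gamma (nu + k%:R))^-1 * (x / 2) ^+ 2 ^+ k))//; ring.
Qed.

End Bessel.

(** * The generalized Marcum Q function *)

Section Marcum.
Variable R : realType.
Local Notation mu := (@lebesgue_measure R).
Local Notation lc := (log_concave_on `[0, +oo[).
Implicit Types nu a b t s : R.

(** The integrand of Q_nu(a, .) without its factor exp(-a^2/2), and with the
    powers of a absorbed in the series, so that it is meaningful at a = 0 and
    nondecreasing in a. *)
Definition marcum_density nu a t : R :=
  2 `^ (1 - nu) * t `^ (2 * nu - 1) * expR (- (t ^+ 2 / 2))
    * bessel_series nu ((a * t / 2) ^+ 2).

Lemma marcum_density_gt0 nu a t : 0 < nu -> 0 < t -> 0 < marcum_density nu a t.
Proof.
move=> nu0 t0; rewrite !mulr_gt0 ?powR_gt0 ?expR_gt0//.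
by rewrite bessel_series_gt0 ?sqr_ge0.
Qed.

Lemma marcum_density_continuous nu a : 0 < nu ->
  {in `]0, +oo[, continuous (marcum_density nu a)}.
Proof.
move=> nu0 t; rewrite in_itv/= andbT => t0; apply: cvgM.
  apply: cvgM.
    by apply: cvgM; [exact: cvg_cst|exact: continuous_powR_gt0].
  apply: (@continuous_comp _ _ _ (fun t => - (t ^+ 2 / 2)) expR); last first.
    exact: continuous_expR.
  by apply: cvgN; apply: cvgM; [exact: exprn_continuous|exact: cvg_cst].
apply: (@continuous_comp _ _ _
  (fun t => (a * t / 2) ^+ 2) (bessel_series nu)); last first.
  exact: bessel_series_continuous.
apply: (@continuous_comp _ _ _ (fun t => a * t / 2) (fun y => y ^+ 2)).
  apply: cvgM; last exact: cvg_cst.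
  by apply: cvgM; [exact: cvg_cst|exact: cvg_id].
exact: exprn_continuous.
Qed.

(** With N = a^2 + 1 the series grows at most like exp(t^2/4), so a factor
    exp(-t^2/4) <= e exp(-t) is left, and the Gamma density of parameter 2 nu
    dominates. *)
Lemma marcum_density_integrable nu a : 0 < nu ->
  mu.-integrable `]0, +oo[ (EFin \o marcum_density nu a).
Proof.
move=> nu0; have nu2 : 0 < 2 * nu by rewrite mulr_gt0.
pose N := a ^+ 2 + 1; have N0 : 0 < N by rewrite ltr_pwDr ?sqr_ge0.
pose C := 2 `^ (1 - nu) * (gamma_tail nu N)^-1 * expR 1.
have C0 : 0 < C by rewrite !mulr_gt0 ?powR_gt0 ?expR_gt0 ?invr_gt0 ?gamma_tail_gt0.
have gi := integrableZl_EFin C (measurable_itv _) (gamma_density_integrable nu2).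
have mf : measurable_fun `](0 : R), +oo[ (EFin \o marcum_density nu a).
  apply/measurable_EFinP; apply: measurable_fun_itvoy.
  exact: marcum_density_continuous.
apply: (@le_integrable _ _ _ mu _ _ _ _ mf _ gi) => // t /=.
rewrite in_itv/= andbT lee_fin => t0.
rewrite !ger0_norm; last 2 first.
  by rewrite mulr_ge0 ?ltW ?gamma_density_gt0.
  exact/ltW/marcum_density_gt0.
have P0 : 0 < 2 `^ (1 - nu) * t `^ (2 * nu - 1) :> R by rewrite mulr_gt0 ?powR_gt0.
rewrite /marcum_density /C /gamma_density.
rewrite [leRHS](_ : _ = 2 `^ (1 - nu) * t `^ (2 * nu - 1) *
   ((gamma_tail nu N)^-1 * (expR 1 * expR (- t)))); last by ring.
rewrite -[leLHS]mulrA ler_pM2l// -expRD.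
have H := @bessel_series_le_expR _ nu N ((a * t / 2) ^+ 2) nu0 N0 (sqr_ge0 _).
rewrite -(ler_pM2l (expR_gt0 (- (t ^+ 2 / 2)))) in H; apply: le_trans H _.
rewrite mulrCA ler_pM2l ?invr_gt0 ?gamma_tail_gt0// -expRD ler_expR.
have -> : (a * t / 2) ^+ 2 / N = t ^+ 2 / 4 * (a ^+ 2 / N) by field; rewrite gt_eqF.
have : a ^+ 2 / N <= 1 by rewrite ler_pdivrMr// mul1r lerDl.
have : 0 <= t ^+ 2 / 4 by rewrite mulr_ge0 ?sqr_ge0.
have : 0 <= (t / 2 - 1) ^+ 2 by rewrite sqr_ge0.
move: (a ^+ 2 / N) => q; nra.
Qed.

Lemma marcumQ_posE nu a b : 0 < nu -> 0 < a -> 0 <= b ->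
  marcumQ_pos nu a b = expR (- (a ^+ 2 / 2)) * tail (marcum_density nu a) b.
Proof.
move=> nu0 a0 b0; rewrite /tail -RintegralZl//; last first.
  by apply: tail_integrable => //; exact: marcum_density_integrable.
apply: eq_Rintegral => t; rewrite inE/= in_itv/= andbT => bt.
have t0 := le_lt_trans b0 bt.
rewrite besselIE ?mulr_gt0// /marcum_density.
rewrite !powRM ?mulr_ge0 ?(ltW a0) ?(ltW t0)// ?invr_ge0//.
rewrite (_ : 2^-1 `^ (nu - 1) = 2 `^ (1 - nu)); last first.
  by rewrite -(@powR_inv1 _ 2)// -powRrM mulN1r opprB.
rewrite (_ : 2 * nu - 1 = nu + (nu - 1)); last by ring.
rewrite [t `^ (nu + (nu - 1))]powRD; last by rewrite (gt_eqF t0) implybT.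
rewrite (_ : - ((t ^+ 2 + a ^+ 2) / 2) = - (t ^+ 2 / 2) + - (a ^+ 2 / 2)); last by ring.
have ap : a `^ (nu - 1) != 0 by rewrite gt_eqF ?powR_gt0.
by rewrite expRD; field.
Qed.

Lemma tail_marcum_density_log_concave nu a : 1 / 2 <= nu ->
  lc (tail (marcum_density nu a)).
Proof.
move=> nu12; have nu0 : 0 < nu by lra.
pose w s : R := 2 `^ (1 - nu) * s `^ (nu - 1 / 2) * expR (- (1 / 2) * s)
  * bessel_series nu (a ^+ 2 / 4 * s).
apply: (@log_concave_tail _ w).
- apply: log_concaveM; last first.
    apply: (@log_concave_scale _ (bessel_series nu)).
      by rewrite mulr_ge0 ?sqr_ge0.
    exact: bessel_series_log_concave.
  apply: log_concaveM; last exact: log_concave_expR.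
  apply: log_concaveM; first by apply: log_concave_cst; rewrite powR_gt0.
  by apply: log_concave_powR; rewrite subr_ge0.
- move=> x x0; rewrite !mulr_gt0 ?powR_gt0 ?expR_gt0//.
  by apply: bessel_series_gt0 => //; rewrite mulr_ge0 ?(ltW x0)// mulr_ge0 ?sqr_ge0.
- move=> t t0; rewrite /marcum_density /w.
  have -> : (t ^+ 2) `^ (nu - 1 / 2) = t `^ (2 * nu - 1).
    by rewrite -(powR_mulrn _ (ltW t0)) -powRrM; congr (_ `^ _); field.
  congr (_ * expR _ * bessel_series nu _); first by ring.
  by field.
- exact: marcum_density_continuous.
- exact: marcum_density_integrable.
Qed.

Lemma marcumQ_pos_log_concave nu a : 1 / 2 <= nu -> 0 < a ->
  lc (marcumQ_pos nu a).
Proof.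
move=> nu12 a0; have nu0 : 0 < nu by lra.
apply: (@eq_log_concave _ _
  (fun b => expR (- (a ^+ 2 / 2)) * tail (marcum_density nu a) b)).
- by move=> b; rewrite in_itv/= andbT => b0; rewrite marcumQ_posE.
- by move=> x y l; rewrite !in_itv/= !andbT; exact: conv_ge0.
apply: log_concaveM; first by apply: log_concave_cst; exact: expR_gt0.
exact: tail_marcum_density_log_concave.
Qed.

Lemma tail_marcum_density_le nu a a' b : 0 < nu -> 0 <= b -> 0 <= a <= a' ->
  tail (marcum_density nu a) b <= tail (marcum_density nu a') b.
Proof.
move=> nu0 b0 /andP[a0 aa'].
have fi c : mu.-integrable `]b, +oo[ (EFin \o marcum_density nu c).
  by apply: tail_integrable => //; exact: marcum_density_integrable.
apply: le_Rintegral => // t /=; rewrite in_itv/= andbT => bt.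
have t0 := le_lt_trans b0 bt.
rewrite /marcum_density ler_pM2l ?mulr_gt0 ?powR_gt0 ?expR_gt0//.
have tt0 : 0 <= t by exact: ltW.
apply: bessel_series_le => //; rewrite sqr_ge0/=.
apply: lerXn2r; rewrite ?nnegrE ?divr_ge0 ?mulr_ge0 ?(le_trans a0 aa')//.
by rewrite ler_pM2r ?invr_gt0// ler_pM2r.
Qed.

(** The tail is monotone in a and bounded below by 0. *)
Lemma marcumQ_pos_cvg0 nu b : 0 < nu -> 0 <= b ->
  cvg (marcumQ_pos nu a b @[a --> 0^'+]).
Proof.
move=> nu0 b0.
have c1 : expR (- (a ^+ 2 / 2)) @[a --> (0:R)^'+] --> expR (- ((0:R) ^+ 2 / 2)).
  apply: cvg_at_right_filter.
  apply: (@continuous_comp _ _ _ (fun t : R => - (t ^+ 2 / 2)) expR); last first.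
    exact: continuous_expR.
  by apply: cvgN; apply: cvgM; [exact: exprn_continuous|exact: cvg_cst].
have c2 : cvg (tail (marcum_density nu a) b @[a --> 0^'+]).
  apply: nondecreasing_at_right_is_cvgr.
    near=> e => x y; rewrite !in_itv/= => /andP[x0 _] _ xy.
    by apply: tail_marcum_density_le => //; rewrite ltW.
  near=> e; exists 0 => _ [x /= + <-]; rewrite in_itv/= => /andP[x0 _].
  apply/ltW/tail_gt0 => //; first exact: marcum_density_integrable.
  by move=> t; exact: marcum_density_gt0.
apply/cvg_ex; eexists; apply: cvg_trans (cvgM c1 c2).
apply: near_eq_cvg; near=> a; rewrite marcumQ_posE//.
Unshelve. all: by end_near. Qed.

Lemma marcumQ_log_concave nu a : 1 / 2 <= nu -> 0 <= a -> lc (marcumQ nu a).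
Proof.
move=> nu12; have nu0 : 0 < nu by lra.
rewrite le_eqVlt => /predU1P[<- {a}|a0]; rewrite /marcumQ; last first.
  under [X in log_concave_on _ X]eq_fun do rewrite gt_eqF//.
  exact: marcumQ_pos_log_concave.
under [X in log_concave_on _ X]eq_fun do rewrite eqxx.
apply: (@log_concave_cvg R _ (0 : R)^'+ _ (marcumQ_pos nu)).
- by move=> b; rewrite in_itv/= andbT => b0; exact: marcumQ_pos_cvg0.
- near=> e; apply: marcumQ_pos_log_concave => //.
- move=> x y l; rewrite !in_itv/= !andbT; exact: conv_ge0.
Unshelve. all: by end_near. Qed.

(** The inequality on [0, 1] reads ln g(b) >= (1 - b) ln g(0) + b ln g(1), and
    g(b) / g(0) - 1 >= ln g(b) - ln g(0). *)
Lemma log_concave_drop (g : R -> R) : lc g -> 0 < g 0 -> 0 < g 1 ->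
  exists M, forall b, 0 < b < 1 -> g 0 - g b <= M * b.
Proof.
move=> [_ gc] g0 g1; exists (g 0 * (ln (g 0) - ln (g 1))) => b b01.
have /andP[b0 b1] := b01.
have := gc 1 0 b; rewrite !in_itv/= !andbT ler01 lexx => /(_ isT isT b01).
rewrite mulr1 mulr0 addr0 => H.
have gb : 0 < g b by apply: lt_le_trans H; rewrite mulr_gt0 ?powR_gt0.
have {}H : b * ln (g 1) + (1 - b) * ln (g 0) <= ln (g b).
  by rewrite -!ln_powR -lnM ?posrE ?powR_gt0// ler_ln ?posrE ?mulr_gt0 ?powR_gt0.
have q0 : 0 < g b / g 0 by rewrite divr_gt0.
have : ln (g b) - ln (g 0) <= g b / g 0 - 1.
  rewrite -ln_div ?posrE//; have := @le_ln1Dx R (g b / g 0 - 1).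
  by rewrite addrCA subrr addr0; apply; lra.
move=> H2; have : b * (ln (g 1) - ln (g 0)) <= g b / g 0 - 1 by lra.
rewrite -(ler_pM2l g0) (_ : g 0 * (g b / g 0 - 1) = g b - g 0); first lra.
by field; rewrite gt_eqF.
Qed.

(** For b < 1 the density is at least a constant times b^(2 nu - 1) on ]0, b],
    so the drop is at least a constant times b^(2 nu). *)
Lemma marcumQ_drop_not_linear nu (M : R) : 0 < nu -> nu < 1 / 2 ->
  ~ forall b, 0 < b < 1 -> marcumQ nu 1 0 - marcumQ nu 1 b <= M * b.
Proof.
move=> nu0 nu12 H; pose e1 : R := expR (- (1 ^+ 2 / 2)).
pose k := e1 * (2 `^ (1 - nu) * expR (- (1 / 2)) * bessel_coef nu 0).
have e0 : 0 < e1 by exact: expR_gt0.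
have k0 : 0 < k by rewrite !mulr_gt0 ?powR_gt0 ?expR_gt0 ?bessel_coef_gt0.
have fi := marcum_density_integrable 1 nu0.
have key b : 0 < b < 1 -> k * b `^ (2 * nu) <= M * b.
  move=> b01; apply: le_trans (H b b01); have /andP[b0 b1] := b01.
  rewrite /marcumQ oner_eq0 !marcumQ_posE ?(ltW b0)// -mulrBr tailB ?lexx ?(ltW b0)//.
  rewrite -mulrA ler_pM2l//.
  have -> : b `^ (2 * nu) = b `^ (2 * nu - 1) * b.
    by rewrite [RHS]mulrC mulr_powRB1 ?(ltW b0)// mulr_gt0.
  pose c := 2 `^ (1 - nu) * expR (- (1 / 2)) * bessel_coef nu 0 * b `^ (2 * nu - 1).
  rewrite mulrA -/c.
  rewrite (_ : c * b = \int[mu]_(t in `]0, b]) c); last first.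
    have mb : mu `]0, b] = b%:E by rewrite lebesgue_measure_itv/= lte_fin b0 sube0.
    transitivity (c * fine (mu `]0, b])); first by rewrite mb.
    by rewrite Rintegral_cst.
  apply: le_Rintegral => //.
  - apply: (@integrableS _ _ _ mu `[0, b]) => //; first exact: subset_itv_oc_cc.
    apply: continuous_compact_integrable; first exact: segment_compact.
    by apply: continuous_subspaceT => ?; exact: cst_continuous.
  - by apply: integrableS fi => //; apply: subset_itvl; rewrite bnd_simp.
  move=> t /=; rewrite in_itv/= => /andP[t0 tb].
  rewrite /c /marcum_density.
  rewrite [leLHS](_ : _ = 2 `^ (1 - nu) * b `^ (2 * nu - 1)
    * expR (- (1 / 2)) * bessel_coef nu 0); last by ring.
  have q0 : 0 <= 1 - 2 * nu by lra.
  apply: ler_pM.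
  - by rewrite !mulr_ge0 ?powR_ge0 ?expR_ge0.
  - exact/ltW/bessel_coef_gt0.
  - apply: ler_pM; rewrite ?mulr_ge0 ?powR_ge0 ?expR_ge0//.
      rewrite ler_pM2l ?powR_gt0// -(opprB 1) !powRN lef_pV2 ?posrE ?powR_gt0//.
      by rewrite ge0_ler_powR// nnegrE ltW.
    rewrite ler_expR; nra.
  - by rewrite -bessel_series0 bessel_series_le ?sqr_ge0 ?lexx.
have : k <= M * 0.
  have p0 : 0 < 1 - 2 * nu by lra.
  apply: (@ler_cvg_to _ (0 : R)^'+ _ _ (cst k) (fun b => M * b `^ (1 - 2 * nu))).
  - exact: cvg_cst.
  - by apply: cvgM; [exact: cvg_cst|exact: powR_cvg0].
  near=> b; have b0 : 0 < b by near: b; exact: nbhs_right_gt.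
  have b1 : b < 1 by near: b; exact: nbhs_right_lt.
  have bp : 0 < b `^ (2 * nu) by rewrite powR_gt0.
  have bE : b `^ (1 - 2 * nu) * b `^ (2 * nu) = b.
    rewrite -powRD; first by rewrite subrK powRr1// ltW.
    by rewrite (gt_eqF b0) implybT.
  rewrite -(ler_pM2r bp) -[X in _ <= X]mulrA bE.
  by apply: key; rewrite b0.
rewrite mulr0; lra.
Unshelve. all: by end_near. Qed.

End Marcum.

Unset Implicit Arguments.

Theorem theorem1 (R : realType) (nu : R) (hnu : 0 < nu) :
  (forall a : R, 0 <= a -> log_concave_on `[0, +oo[ (fun b : R => marcumQ nu a b))
  <-> 1 / 2 <= nu.
Proof.
split=> [H|nu12 a a0]; last exact: marcumQ_log_concave.
rewrite leNgt; apply/negP => nu12.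
have Q0 b : 0 <= b -> 0 < marcumQ nu 1 b.
  move=> b0; rewrite /marcumQ oner_eq0 marcumQ_posE// mulr_gt0 ?expR_gt0//.
  apply: tail_gt0 => //; first exact: marcum_density_integrable.
  by move=> t; exact: marcum_density_gt0.
have [M HM] := log_concave_drop (H 1 ler01) (Q0 0 (lexx _)) (Q0 1 ler01).
exact: marcumQ_drop_not_linear HM.
Qed.
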